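(* The weight function $$\widetilde{w}_4(\lambda,x)=\exp\Big(\frac{(1+x)^\lambda-1}{\lambda}\Big)-x,\qquad \lambda>0,\ x>0,$$ is $\mathrm{STP}_\infty$.
   Context: A real function $w(\lambda,x)$ on $(0,\infty)\times(0,\infty)$ is $\mathrm{STP}_\infty$ (strictly totally positive of order infinity) if for every $r\ge 1$, all $\lambda_1>\cdots>\lambda_r>0$ and all $x_1>\cdots>x_r>0$, the $r\times r$ determinant $\det(w(\lambda_i,x_j))$ is $>0$. *)

(* Defs.v *)
From mathcomp Require Import all_boot all_order all_algebra.
From mathcomp Require Import all_classical all_reals all_analysis.
Set Implicit Arguments.
Unset Strict Implicit.
Unset Printing Implicit Defensive.
Import Order.TTheory GRing.Theory Num.Theory.
Local Open Scope ring_scope.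

(* A real function on (0,oo) x (0,oo) is represented by a total function
   w : R -> R -> R of which only the values at positive arguments matter. *)
Definition STP_infinity (R : realType) (w : R -> R -> R) : Prop :=
  forall (r : nat) (lambda x : 'I_r -> R),
    (1 <= r)%N ->
    (forall i, 0 < lambda i) ->
    (forall i j : 'I_r, (i < j)%N -> lambda j < lambda i) ->
    (forall i, 0 < x i) ->
    (forall i j : 'I_r, (i < j)%N -> x j < x i) ->
    0 < \det (\matrix_(i < r, j < r) w (lambda i) (x j)).

Definition w4_tilde (R : realType) (lambda x : R) : R :=
  expR (((1 + x) `^ lambda - 1) / lambda) - x.

(* Main.v *)
Require Import Defs.
From mathcomp Require Import all_boot all_order all_algebra all_fingroup.
From mathcomp Require Import all_classical all_reals all_analysis.
From mathcomp Require Import zify ring.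

(** Put y = ln (1 + x) and let P_n(l) = sum_k S(n, k) l^(n - k), S being the
    Stirling subset numbers. Then exp ((e^(l y) - 1) / l) = sum_n P_n(l) y^n / n!
    (Dobinski's formula and an exchange of summations), so the weight equals
    1 + sum_(n >= 2) (P_n(l) - 1) y^n / n!. By the Cauchy-Binet formula its
    determinants are sums of products of a generalized Vandermonde determinant
    in l, a minor of the coefficient matrix of the P_n, and a generalized
    Vandermonde determinant in y. It remains to see that the coefficient matrix is
    totally nonnegative (one product being positive).

    With z = 1/l, the polynomials
      a(n, i) = l^n e^(-z) sum_k z^k k^(n - i) (k + 1)^i / k!,   i <= n,
    form a triangle of Bell type: a(n, 0) = P_n, a(n + 1, 0) = a(n, n) and
    a(n + 1, i + 1) = a(n + 1, i) + l a(n, i). Read linearly, it is a sequence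
    with u_0 = 1 and u_(s+1) = u_s + l u_(d s), d nondecreasing. Hence its
    coefficient matrix U satisfies U = L (1 (+) U o d), where L takes partial sums
    of rows, and all three operations preserve total nonnegativity. *)

Set Implicit Arguments.
Unset Strict Implicit.
Unset Printing Implicit Defensive.
Import Order.TTheory GRing.Theory Num.Theory.
Import numFieldNormedType.Exports.
Local Open Scope classical_set_scope.
Local Open Scope ring_scope.

(** * Minors and the Cauchy-Binet formula *)

Definition minor (R : comNzRingType) (S T : Type) (X : S -> T -> R) (r : nat)
    (f : 'I_r -> S) (g : 'I_r -> T) : R :=
  \det (\matrix_(i < r, j < r) X (f i) (g j)).

Definition increasing (r : nat) (f : 'I_r -> nat) : Prop :=
  forall i j : 'I_r, (i < j)%N -> (f i < f j)%N.

Section Minors.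
Variable R : comNzRingType.

Lemma eq_minor (S T S' T' : Type) (X : S -> T -> R) (Y : S' -> T' -> R)
    (r : nat) (f : 'I_r -> S) (g : 'I_r -> T) (f' : 'I_r -> S')
    (g' : 'I_r -> T') :
  (forall i j, X (f i) (g j) = Y (f' i) (g' j)) -> minor X f g = minor Y f' g'.
Proof. by move=> e; congr (\det _); apply/matrixP => i j; rewrite !mxE. Qed.

Lemma minor_tr (S T : Type) (X : S -> T -> R) (r : nat) (f : 'I_r -> S)
    (g : 'I_r -> T) : minor X f g = minor (fun t s => X s t) g f.
Proof.
by rewrite /minor -det_tr; congr (\det _); apply/matrixP => i j; rewrite !mxE.
Qed.

Lemma minor_perm (S T : Type) (X : S -> T -> R) (r : nat) (f : 'I_r -> S)
    (g : 'I_r -> T) (s : 'S_r) : minor X (f \o s) g = (-1) ^+ s * minor X f g.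
Proof.
rewrite /minor -det_perm -det_mulmx -row_permE; congr (\det _).
by apply/matrixP => i j; rewrite !mxE.
Qed.

Lemma minor_rev (S T : Type) (X : S -> T -> R) (r : nat) (f : 'I_r -> S)
    (g : 'I_r -> T) :
  minor X (f \o @rev_ord r) (g \o @rev_ord r) = minor X f g.
Proof.
pose s := perm (@rev_ord_inj r).
have -> : minor X (f \o @rev_ord r) (g \o @rev_ord r) = minor X (f \o s) (g \o s).
  by apply: eq_minor => i j /=; rewrite !permE.
by rewrite minor_perm minor_tr minor_perm signrMK -minor_tr.
Qed.

Lemma minor_eq0 (S T : Type) (X : S -> T -> R) (r : nat) (f : 'I_r -> S)
    (g : 'I_r -> T) (i j : 'I_r) :
  i != j -> (forall k, X (f i) (g k) = X (f j) (g k)) -> minor X f g = 0.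
Proof.
by move=> ij e; apply: (determinant_alternate ij) => k; rewrite !mxE.
Qed.

(** Multilinearity in the rows: [g] selects one summand per row. The coefficients may vary with the
    row, which later allows sums over disjoint blocks. *)
Lemma det_sum_rows (r N : nat) (c : 'I_r -> 'I_N -> R) (T : Type)
    (Y : 'I_N -> T -> R) (h : 'I_r -> T) :
  \det (\matrix_(i < r, j < r) \sum_k c i k * Y k (h j)) =
  \sum_(g : {ffun 'I_r -> 'I_N}) (\prod_i c i (g i)) * minor Y g h.
Proof.
transitivity (\sum_(g : {ffun 'I_r -> 'I_N}) \sum_(s : 'S_r)
    (-1) ^+ s * \prod_i (c i (g i) * Y (g i) (h (s i)))).
  rewrite exchange_big; apply: eq_bigr => /= s _; rewrite -big_distrr /=.
  congr (_ * _); rewrite -(bigA_distr_bigA (fun i k => c i k * Y k (h (s i)))).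
  by apply: eq_bigr => i _; rewrite mxE.
apply: eq_bigr => g _; rewrite big_distrr /=; apply: eq_bigr => s _.
rewrite big_split /= mulrCA; congr (_ * (_ * _)).
by apply: eq_bigr => i _; rewrite mxE.
Qed.

(* Symmetrizing the expansion of det_sum_rows over 'S_r: a sum over all index
   maps rather than over increasing ones, hence the factor r!. *)
Lemma cauchy_binet (S T : Type) (r N : nat) (X : S -> 'I_N -> R)
    (Y : 'I_N -> T -> R) (f : 'I_r -> S) (h : 'I_r -> T) :
  (r`!)%:R * minor (fun s t => \sum_k X s k * Y k t) f h =
  \sum_(g : {ffun 'I_r -> 'I_N}) minor X f g * minor Y g h.
Proof.
have E (s : 'S_r) : minor (fun s t => \sum_k X s k * Y k t) f h =
    \sum_(g : {ffun 'I_r -> 'I_N})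
      (-1) ^+ s * (\prod_i X (f i) (g (s i))) * minor Y g h.
  rewrite {1}/minor (det_sum_rows (fun i k => X (f i) k)).
  rewrite (reindex_inj
    (h := fun g : {ffun 'I_r -> 'I_N} => [ffun i => g (s i)])); last first.
    move=> g g' /ffunP e; apply/ffunP => i.
    by have := e (s^-1%g i); rewrite !ffunE permKV.
  apply: eq_bigr => g _.
  have -> : minor Y [ffun i => g (s i)] h = minor Y (g \o s) h.
    by apply: eq_minor => i j /=; rewrite ffunE.
  rewrite minor_perm mulrCA mulrA; congr (_ * _ * _).
  by apply: eq_bigr => i _; rewrite ffunE.
rewrite mulr_natl -card_Sn -sumr_const.
rewrite (eq_bigr (fun s : 'S_r => \sum_(g : {ffun 'I_r -> 'I_N})
      (-1) ^+ s * (\prod_i X (f i) (g (s i))) * minor Y g h)); last by move=> s _; exact: E.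
rewrite exchange_big; apply: eq_bigr => g _; rewrite -big_distrl /=.
by congr (_ * _); apply: eq_bigr => s _; congr (_ * _); apply: eq_bigr => i _; rewrite mxE.
Qed.

End Minors.

(** * Lower bounds from the Cauchy-Binet formula *)

Lemma sort_injective (r : nat) (g : 'I_r -> nat) :
  injective g -> exists s : 'S_r, increasing (g \o s).
Proof.
move=> gi; pose t := [tuple g i | i < r].
have /tuple_permP[s es] : perm_eq (sort leq t) t by rewrite perm_sort.
exists s => i j ij /=.
have ut : uniq t.
  by rewrite map_inj_uniq ?enum_uniq.
have : sorted ltn (sort leq t).
  by rewrite ltn_sorted_uniq_leq sort_uniq ut sort_sorted //; exact: leq_total.
rewrite es => /(sorted_ltn_nth ltn_trans 0%N) /(_ i j).
rewrite !inE size_tuple !ltn_ord => /(_ isT isT ij).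
by rewrite -!tnth_nth !tnth_mktuple.
Qed.

Section Positivity.
Variable R : realDomainType.

(** Sorting [g] multiplies both minors by the same sign, and a repeated value of [g] makes the
    second minor vanish. *)
Lemma minor_mul_ge0 (S T : Type) (r N : nat) (X : S -> nat -> R) (Y : nat -> T -> R)
    (f : 'I_r -> S) (h : 'I_r -> T) (g : 'I_r -> 'I_N) :
  (forall g : 'I_r -> nat, increasing g -> (forall i, g i < N)%N ->
     0 <= minor X f g * minor Y g h) ->
  0 <= minor X f (fun i => g i : nat) * minor Y (fun i => g i : nat) h.
Proof.
move=> P; have [/injectiveP gi|/injectivePn[i [j ij gij]]] := boolP (injectiveb g).
  have gi' : injective (fun i => g i : nat) by move=> i j /val_inj /gi.
  have [s gs] := sort_injective gi'; have := P _ gs (fun i => ltn_ord (g (s i))).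
  rewrite (minor_perm Y) minor_tr minor_perm -minor_tr.
  by rewrite mulrACA -signr_addb addbb mul1r.
by rewrite (minor_eq0 (X := Y) ij) ?mulr0 // => k; rewrite gij.
Qed.

(** All terms of the Cauchy-Binet sum are nonnegative, so the single term [g0] bounds it from
    below. *)
Lemma minor_comp_ge (S T : Type) (r N : nat) (X : S -> nat -> R) (Y : nat -> T -> R)
    (f : 'I_r -> S) (h : 'I_r -> T) (g0 : 'I_r -> nat) :
  (forall i, g0 i < N)%N ->
  (forall g : 'I_r -> nat, increasing g -> (forall i, g i < N)%N ->
     0 <= minor X f g * minor Y g h) ->
  minor X f g0 * minor Y g0 h <=
  (r`!)%:R * minor (fun s t => \sum_(k < N) X s k * Y k t) f h.
Proof.
move=> g0N P.
rewrite (cauchy_binet (fun s (k : 'I_N) => X s k) (fun k : 'I_N => Y k)).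
rewrite (bigD1 [ffun i => Ordinal (g0N i)]) //=.
rewrite -[leLHS]addr0 lerD //.
  rewrite le_eqVlt; apply/orP; left; apply/eqP.
  by congr (_ * _); apply: eq_minor => i j; rewrite ffunE.
apply: sumr_ge0 => g _; exact: minor_mul_ge0.
Qed.

End Positivity.

(** * Total nonnegativity *)

Section Elimination.
Variable R : comNzRingType.

(** Multiplication by the unit lower bidiagonal matrix [D]. The first row has no predecessor
    ([inord 0.-1] is row 0 itself), hence [c ord0 = 0]. *)
Lemma det_row_elim (n : nat) (c : 'I_n.+1 -> R) (A : 'I_n.+1 -> 'I_n.+1 -> R) :
  c ord0 = 0 ->
  \det (\matrix_(i < n.+1, j < n.+1) A i j) =
  \det (\matrix_(i < n.+1, j < n.+1) (A i j - c i * A (inord i.-1) j)).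
Proof.
move=> c0.
pose D : 'M[R]_n.+1 :=
  \matrix_(i, k) ((i == k)%:R - c i * (k == inord i.-1)%:R).
have predE (i : 'I_n.+1) : (inord i.-1 : 'I_n.+1) = i.-1 :> nat.
  by rewrite inordK //; have := ltn_ord i; lia.
have D1 : \det D = 1.
  rewrite det_trig.
    apply: big1 => i _; rewrite mxE eqxx.
    have [->|i0] := eqVneq i ord0; first by rewrite c0 mul0r subr0.
    rewrite -val_eqE /= predE.
    have -> : (i == i.-1 :> nat) = false.
      by apply/eqP; move: i0; rewrite -val_eqE /=; lia.
    by rewrite mulr0 subr0.
  apply/is_trig_mxP => i j ij; rewrite mxE.
  have -> : (i == j) = false by apply/eqP => e; move: ij; rewrite e ltnn.
  have -> : (j == inord i.-1) = false.
    by rewrite -val_eqE /= predE; apply/eqP; lia.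
  by rewrite mulr0 subr0.
rewrite -[LHS]mul1r -D1 -det_mulmx; congr (\det _).
apply/matrixP => i j; rewrite !mxE.
under eq_bigr do rewrite !mxE mulrBl -mulrA.
rewrite sumrB -big_distrr /=; congr (_ - _ * _).
  rewrite (bigD1 i) //= eqxx mul1r big1 ?addr0 // => k ki.
  by rewrite eq_sym (negbTE ki) mul0r.
rewrite (bigD1 (inord i.-1)) //= eqxx mul1r big1 ?addr0 // => k ki.
by rewrite (negbTE ki) mul0r.
Qed.

Lemma det_row0 (n : nat) (A : 'M[R]_n.+1) :
  (forall j, A ord0 (lift ord0 j) = 0) ->
  \det A = A ord0 ord0 *
    \det (\matrix_(i < n, j < n) A (lift ord0 i) (lift ord0 j)).
Proof.
move=> A0; rewrite (expand_det_row _ ord0) big_ord_recl big1 ?addr0; last first.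
  by move=> j _; rewrite A0 mul0r.
rewrite /cofactor addn0 expr0 mul1r; congr (_ * \det _).
by apply/matrixP => i j; rewrite !mxE.
Qed.

Lemma det_col0 (n : nat) (A : 'M[R]_n.+1) :
  (forall i, A (lift ord0 i) ord0 = 0) ->
  \det A = A ord0 ord0 *
    \det (\matrix_(i < n, j < n) A (lift ord0 i) (lift ord0 j)).
Proof.
move=> A0; rewrite -det_tr det_row0; last by move=> j; rewrite mxE.
rewrite mxE -det_tr; congr (_ * \det _).
by apply/matrixP => i j; rewrite !mxE.
Qed.

End Elimination.

Section TotalPositivity.
Variable R : realDomainType.

(** Only the columns are bounded, by [M], since [tp_delayed] is an induction on the number of
    columns. *)
Definition tp (M : nat) (X : nat -> nat -> R) : Prop :=
  forall (r : nat) (f g : 'I_r -> nat),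
    increasing f -> increasing g -> (forall j, g j < M)%N -> 0 <= minor X f g.

Definition direct_sum1 (X : nat -> nat -> R) (s m : nat) : R :=
  match s, m with
  | 0, 0 => 1
  | s'.+1, m'.+1 => X s' m'
  | _, _ => 0
  end.

Definition row_sums (X : nat -> nat -> R) (s m : nat) : R :=
  \sum_(t < s.+1) X t m.

Lemma minor0 (S T : Type) (X : S -> T -> R) (f : 'I_0 -> S) (g : 'I_0 -> T) :
  minor X f g = 1.
Proof. by rewrite /minor det_mx00. Qed.

Lemma increasing_ge0 (n : nat) (f : 'I_n.+1 -> nat) (i : 'I_n) :
  increasing f -> (0 < f (lift ord0 i))%N.
Proof. by move=> fi; have := fi ord0 (lift ord0 i) isT; lia. Qed.

(** If row 0 and column 0 are both selected, the corner 1 splits off; if only one is, it is zero on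
    the selection; if neither is, a shifted minor of [X] remains. *)
Lemma tp_direct_sum1 (M : nat) (X : nat -> nat -> R) :
  tp M X -> tp M.+1 (direct_sum1 X).
Proof.
move=> TX [|n] f g fi gi gM; first by rewrite minor0.
have [f0|f0] := posnP (f ord0); have [g0|g0] := posnP (g ord0).
- rewrite /minor det_row0; last first.
    move=> j; rewrite mxE f0.
    by have := increasing_ge0 j gi; case: (g _).
  rewrite mxE f0 g0 /= mul1r.
  set A := \matrix_(_, _) _.
  have -> : A = \matrix_(i < n, j < n) X (f (lift ord0 i)).-1 (g (lift ord0 j)).-1.
    apply/matrixP => i j; rewrite !mxE.
    by move: (increasing_ge0 i fi) (increasing_ge0 j gi); case: (f _); case: (g _).
  apply: (TX n (fun i => (f (lift ord0 i)).-1) (fun i => (g (lift ord0 i)).-1)).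
  + move=> i j ij; have := fi (lift ord0 i) (lift ord0 j) ij.
    by move: (increasing_ge0 i fi); lia.
  + move=> i j ij; have := gi (lift ord0 i) (lift ord0 j) ij.
    by move: (increasing_ge0 i gi); lia.
  + by move=> j; have := gM (lift ord0 j); move: (increasing_ge0 j gi); lia.
- rewrite /minor (expand_det_row _ ord0) big1 // => j _; rewrite mxE f0.
  suff : (0 < g j)%N by case: (g j) => //= *; rewrite mul0r.
  by have [k ->|->//] := unliftP ord0 j; exact: increasing_ge0.
- rewrite /minor (expand_det_col _ ord0) big1 // => i _; rewrite mxE g0.
  suff : (0 < f i)%N by case: (f i) => //= *; rewrite mul0r.
  by have [k ->|->//] := unliftP ord0 i; exact: increasing_ge0.
- have fp i : (0 < f i)%N.
    by case: (unliftP ord0 i) => [k ->|->//]; exact: increasing_ge0.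
  have gp i : (0 < g i)%N.
    by case: (unliftP ord0 i) => [k ->|->//]; exact: increasing_ge0.
  have -> : minor (direct_sum1 X) f g = minor X (predn \o f) (predn \o g).
    apply: eq_minor => i j /=.
    by move: (fp i) (gp j); case: (f i); case: (g j).
  apply: TX => [i j ij|i j ij|j] /=.
  + by have := fi i j ij; have := fp i; lia.
  + by have := gi i j ij; have := gp i; lia.
  + by have := gM j; have := gp j; lia.
Qed.

Lemma increasing_succ (n : nat) (f : 'I_n.+1 -> nat) :
  (forall i : 'I_n.+1, (0 < i)%N -> (f (inord i.-1) < f i)%N) -> increasing f.
Proof.
move=> H.
have K (k l : nat) : (k + l.+1 < n.+1)%N -> (f (inord k) < f (inord (k + l.+1)))%N.
  elim: l => [|l IH] kl.
    have := H (inord (k + 1)); rewrite inordK ?addn1 //= => [|]; last by lia.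
    exact.
  apply: (@ltn_trans (f (inord (k + l.+1)))); first by apply: IH; lia.
  have := H (inord (k + l.+2)); rewrite inordK ?addnS //= => [|]; last by lia.
  exact.
move=> i j ij.
have := K i (j - i).-1; rewrite (_ : (i + (j - i).-1.+1 = j)%N); last by lia.
by rewrite !inord_val; apply.
Qed.

(* Subtracting consecutive rows leaves sums over the disjoint, successive
   blocks (f (i-1), f i], so expanding by multilinearity only produces minors
   of X with increasing rows. *)
Lemma tp_row_sums (M : nat) (X : nat -> nat -> R) : tp M X -> tp M (row_sums X).
Proof.
move=> TX [|n] f g fi gi gM; first by rewrite minor0.
pose N := (f ord_max).+1.
pose c (i : 'I_n.+1) : R := (0 < i)%:R.
pose e (i : 'I_n.+1) (t : 'I_N) : R :=
  ((t <= f i) && ((0 < i) ==> (f (inord i.-1) < t)))%N%:R.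
have predK (i : 'I_n.+1) : (inord i.-1 : 'I_n.+1) = i.-1 :> nat.
  by rewrite inordK //; have := ltn_ord i; lia.
have fN i : (f i < N)%N.
  rewrite /N ltnS; have [->//|iN] := eqVneq i ord_max.
  apply/ltnW/fi; move: iN; rewrite -val_eqE /=; have := ltn_ord i; lia.
have RE (i : 'I_n.+1) m : row_sums X (f i) m = \sum_(t < N) (t <= f i)%N%:R * X t m.
  rewrite /row_sums (big_ord_widen N (fun t => X t m)) ?fN // big_mkcond.
  by apply: eq_bigr => t _; rewrite ltnS; case: ifP; rewrite ?mul1r ?mul0r.
rewrite /minor (@det_row_elim _ _ c) //.
have -> : \matrix_(i < n.+1, j < n.+1) (row_sums X (f i) (g j) -
     c i * row_sums X (f (inord i.-1)) (g j)) =
   \matrix_(i < n.+1, j < n.+1) \sum_t e i t * X t (g j).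
  apply/matrixP => i j; rewrite !mxE !RE big_distrr -sumrB /=.
  apply: eq_bigr => t _; rewrite mulrA -mulrBl; congr (_ * _).
  rewrite /e /c; have [i0|i0] := posnP i; first by rewrite mul0r subr0 andbT.
  rewrite mul1r implyTb.
  have lt : (f (inord i.-1) < f i)%N by apply: fi; rewrite predK; lia.
  case: (leqP t (f (inord i.-1))) => h; last by rewrite andbT subr0.
  by rewrite (leq_trans h (ltnW lt)) subrr.
rewrite (det_sum_rows e (fun t : 'I_N => X t)); apply: sumr_ge0 => h _.
have [/forallP P|/forallPn[i hi]] := boolP [forall i, e i (h i) != 0]; last first.
  move: hi; rewrite negbK => /eqP hi.
  by rewrite (bigD1 i) //= hi !mul0r.
have {}P i : (h i <= f i)%N && ((0 < i)%N ==> (f (inord i.-1) < h i)%N).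
  by have := P i; rewrite /e; case: (_ && _); rewrite ?eqxx.
apply: mulr_ge0; first by apply: prodr_ge0 => i _; exact: ler0n.
rewrite (_ : minor _ h g = minor X (fun i => h i : nat) g); last exact: eq_minor.
apply: TX => //; apply: increasing_succ => i i0.
have /andP[_] := P i; rewrite i0 /=; apply: leq_ltn_trans.
by have /andP[] := P (inord i.-1).
Qed.

(** If [d] identifies two selected rows, the minor is zero; otherwise [d \o f] is again
    increasing. *)
Lemma tp_comp (M : nat) (X : nat -> nat -> R) (d : nat -> nat) :
  {homo d : s t / (s <= t)%N} -> tp M X -> tp M (X \o d).
Proof.
move=> dm TX r f g fi gi gM.
have [/injectiveP di|/injectivePn[i [j ij dij]]] := boolP (injectiveb (d \o f)).
  apply: (TX r (d \o f)) => // i j ij /=.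
  rewrite ltn_neqAle dm ?andbT; last exact/ltnW/fi.
  by apply/eqP => e; have /di E := e; move: ij; rewrite E ltnn.
by rewrite (minor_eq0 ij) // => k /=; rewrite [d (f i)]dij.
Qed.

(* Coefficient of l ^ m in the polynomials u_0 = 1, u_(s+1) = u_s + l * u_(d s). *)
Fixpoint delayed (d : nat -> nat) (m s : nat) : R :=
  if m is m'.+1 then \sum_(t < s) delayed d m' (d t) else 1.

Lemma delayed_recr (d : nat -> nat) (m s : nat) :
  delayed d m.+1 s.+1 = delayed d m.+1 s + delayed d m (d s).
Proof. by rewrite /= big_ord_recr. Qed.

(** The identity U = L (1 (+) U o d) expresses the first M + 1 columns of U through its first M
    columns. *)
Lemma tp_delayed (d : nat -> nat) (M : nat) :
  {homo d : s t / (s <= t)%N} -> tp M (fun s m => delayed d m s).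
Proof.
move=> dm; elim: M => [|M IH].
  by move=> [|n] f g fi gi gM; [rewrite minor0|have := gM ord0].
move=> r f g fi gi gM.
rewrite (_ : minor _ f g =
    minor (row_sums (direct_sum1 ((fun s m => delayed d m s) \o d))) f g).
  by apply: tp_row_sums => //; apply: tp_direct_sum1; exact: tp_comp.
apply: eq_minor => i j; rewrite /row_sums big_ord_recl.
by case: (g j) => [|m] /=; rewrite ?add0r // big1 ?addr0.
Qed.

(** Induction on [r]: clear the column of a = [x ord0] by subtracting multiples of the previous row,
    take x_j - a out of each other column, and expand the rest into generalized Vandermonde minors
    of smaller size. *)
Lemma minor_exp_gt0 (r : nat) (x : 'I_r -> R) (m : 'I_r -> nat) :
  (forall i, 0 < x i) -> (forall i j : 'I_r, (i < j)%N -> x i < x j) ->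
  increasing m -> 0 < minor (fun n y => y ^+ n) m x.
Proof.
elim: r x m => [|n IH] x m xp xi mi; first by rewrite minor0 ltr01.
have lt_inord (i : 'I_n) : ((inord i : 'I_n.+1) < lift ord0 i)%N.
  by rewrite lift0 inordK ltnS // ltnW.
pose a := x ord0.
pose c (i : 'I_n.+1) : R := if (0 < i)%N then a ^+ (m i - m (inord i.-1)) else 0.
rewrite /minor (@det_row_elim _ _ c) // det_col0; last first.
  move=> i; rewrite mxE /c /= -/a -exprD subnK ?subrr //.
  exact/ltnW/mi/lt_inord.
rewrite mxE /c ltnn mul0r subr0 mulr_gt0 ?exprn_gt0 //.
pose p (i : 'I_n) := m (inord i).
have pm (i : 'I_n) : (p i < m (lift ord0 i))%N.
  exact/mi/lt_inord.
pose N := (m ord_max).+1.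
have mN i : (m i < N)%N.
  rewrite /N ltnS; have [->//|iN] := eqVneq i ord_max.
  apply/ltnW/mi; move: iN; rewrite -val_eqE /=; have := ltn_ord i; lia.
pose e (i : 'I_n) (k : 'I_N) : R :=
  if (p i <= k < m (lift ord0 i))%N then a ^+ ((m (lift ord0 i)).-1 - k) else 0.
pose B : 'M[R]_n := \matrix_(i, j) \sum_k e i k * (x (lift ord0 j)) ^+ k.
set A := \matrix_(_, _) _.
have -> : A = B *m diag_mx (\row_j (x (lift ord0 j) - a)).
  apply/matrixP => i j; rewrite mul_mx_diag !mxE /=.
  set y := x _; set q := m (lift ord0 i).
  (* With p = [m (inord i)], this is y - a times the sum of a^(q-1-k) y^k over p <= k < q. *)
  have -> : y ^+ q - a ^+ (q - m (inord i)) * y ^+ m (inord i) =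
      \sum_(p i <= k < q) (a ^+ (q - k.+1) * y ^+ k.+1 - a ^+ (q - k) * y ^+ k).
    by rewrite telescope_sumr ?subnn ?expr0 ?mul1r //; exact/ltnW/pm.
  rewrite big_distrl /= (@big_nat_widenl _ _ _ _ 0) // (big_nat_widen _ _ N) ?mN // 1?ltnW ?mN //.
  rewrite big_mkord big_mkcond /=; apply: eq_bigr => k _.
  rewrite /e -/q andbC; case: ifP => [/andP[h1 h2]|_]; last by rewrite !mul0r.
  rewrite (_ : q - k = (q.-1 - k).+1)%N; last by lia.
  by rewrite (_ : q - k.+1 = (q.-1 - k))%N; [rewrite !exprS; ring|lia].
rewrite det_mulmx det_diag mulr_gt0 //; last first.
  by apply: prodr_gt0 => j _; rewrite mxE subr_gt0; apply: xi.
rewrite (det_sum_rows e (fun (k : 'I_N) y => y ^+ k)).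
have pos (h : {ffun 'I_n -> 'I_N}) :
    (forall i, p i <= h i < m (lift ord0 i))%N ->
    0 < (\prod_i e i (h i)) * minor (fun (k : 'I_N) y => y ^+ k) h (x \o lift ord0).
  move=> H; apply: mulr_gt0.
    by apply: prodr_gt0 => i _; rewrite /e H exprn_gt0 // /a xp.
  apply: (IH (x \o lift ord0) (fun i => h i : nat)) => [i|i j ij|i j ij] //=.
    exact: xi.
  (* The exponents lie in successive disjoint intervals, so [h] is increasing. *)
  have /andP[_ h1] := H i; have /andP[h2 _] := H j.
  apply: (leq_trans h1); apply: leq_trans h2; rewrite /p.
  have [->//|ne] := eqVneq (lift ord0 i) (inord j).
  apply/ltnW/mi; move: ne; rewrite -val_eqE /= inordK; last by have := ltn_ord j; lia.
  by rewrite /bump /=; lia.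
have pN (i : 'I_n) : (p i < N)%N by exact: mN.
(* The left ends [p i] of the intervals give one positive term; the others are nonnegative. *)
rewrite (bigD1 [ffun i => Ordinal (pN i)]) //=.
apply: ltr_wpDr; last by apply: pos => i; rewrite ffunE /= leqnn pm.
apply: sumr_ge0 => h _.
have [/forallP P|/forallPn[i hi]] :=
    boolP [forall i : 'I_n, p i <= h i < m (lift ord0 i)]%N; first exact/ltW/pos.
by rewrite (bigD1 i) //= /e (negbTE hi) !mul0r.
Qed.

End TotalPositivity.

(** * The Bell triangle *)

(* The Bell (Aitken) triangle, entry i <= n of row n stored at 'C(n, 2) + i; the
   last entry of a row is also the first entry of the next one. *)
Fixpoint bell_level (s : nat) : nat :=
  if s is s'.+1 then
    if (s <= 'C((bell_level s').+1, 2))%N then bell_level s' else (bell_level s').+1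
  else 0.

Lemma bell_levelS (s : nat) : bell_level s.+1 =
  if (s.+1 <= 'C((bell_level s).+1, 2))%N then bell_level s else (bell_level s).+1.
Proof. by []. Qed.

(** For s = 'C(n + 1, 2) + i with i <= n, the step to a(n + 1, i + 1) adds l a(n, i), stored n + 1
    places before s + 1; [bell_level] recovers n + 1. *)
Definition bell_delay (s : nat) : nat := (s.+1 - bell_level s.+1)%N.

(** The level grows by at most one per step. *)
Lemma bell_delay_homo : {homo bell_delay : s t / (s <= t)%N}.
Proof.
apply: homo_leq => //; first exact: leq_trans.
move=> s; rewrite /bell_delay (bell_levelS s.+1).
by case: ifP => _; lia.
Qed.

Lemma binS2 (n : nat) : 'C(n.+1, 2) = ('C(n, 2) + n)%N.
Proof. by rewrite binS bin1 addnC. Qed.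

Lemma bell_levelE (n i : nat) : (i <= n)%N -> bell_level ('C(n.+1, 2) + i.+1) = n.+1.
Proof.
elim: n i => [|n IHn] i; first by rewrite leqn0 => /eqP ->.
elim: i => [_|i IHi lein].
  have e : bell_level 'C(n.+2, 2) = n.+1 by rewrite binS2 IHn.
  by rewrite addn1 bell_levelS e ltnn.
rewrite addnS bell_levelS (IHi (ltnW lein)) ifT //.
by rewrite [X in (_ <= X)%N]binS2; lia.
Qed.

Lemma bell_delayE (n i : nat) : (i <= n)%N ->
  bell_delay ('C(n.+1, 2) + i) = ('C(n, 2) + i)%N.
Proof.
by move=> lein; rewrite /bell_delay -addnS bell_levelE // binS2; lia.
Qed.

Section BellCoefficients.
Variable R : realDomainType.

Definition bell_coef (n i m : nat) : R := delayed R bell_delay m ('C(n, 2) + i).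

Lemma bell_coefS (n i m : nat) : (i <= n)%N ->
  bell_coef n.+1 i.+1 m.+1 = bell_coef n.+1 i m.+1 + bell_coef n i m.
Proof. by move=> h; rewrite /bell_coef addnS delayed_recr bell_delayE. Qed.

Lemma bell_coefn0 (n m : nat) : bell_coef n.+1 0 m = bell_coef n n m.
Proof. by rewrite /bell_coef binS2 addn0. Qed.

(** The summand [(i == n)] records that only the last entry of row n reaches degree n. *)
Lemma bell_coef_eq0 (n i m : nat) :
  (i <= n)%N -> (n + (i == n) <= m)%N -> bell_coef n i m = 0.
Proof.
elim: n i m => [|n IHn] i m.
  by rewrite leqn0 => /eqP ->; case: m => // m _; rewrite /bell_coef /= big_ord0.
elim: i m => [m _ le|i IHi [|m] //].
  by rewrite bell_coefn0 IHn // eqxx addn1 (leq_trans _ le) // leq_addr.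
move=> lein le; rewrite bell_coefS // IHi ?add0r; [|lia|lia].
by apply: IHn => //; move: le; rewrite eqSS; lia.
Qed.

Lemma bell_coef_lead (n : nat) : bell_coef n n n = 1.
Proof.
elim: n => [//|n IHn]; rewrite bell_coefS // bell_coef_eq0 ?add0r //.
by rewrite ltn_eqF // addn0.
Qed.

Lemma bell_coef0 (n i : nat) : bell_coef n i 0 = 1.
Proof. by []. Qed.

(** The recurrences determine the triangle. Here [v] will be the normalized Dobinski sums. *)
Lemma bell_triangleE (l : R) (v : nat -> nat -> R) :
  v 0 0 = 1 -> (forall n, v n.+1 0 = v n n) ->
  (forall n i, (i <= n)%N -> v n.+1 i.+1 = v n.+1 i + l * v n i) ->
  forall n i N, (i <= n < N)%N -> v n i = \sum_(m < N) bell_coef n i m * l ^+ m.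
Proof.
move=> v0 vn0 vS; elim=> [|n IHn] i N.
  case/andP; rewrite leqn0 => /eqP -> {i}; case: N => // N _.
  rewrite v0 big_ord_recl bell_coef0 expr0 mulr1 big1 ?addr0 // => m _.
  by rewrite bell_coef_eq0 ?mul0r.
elim: i => [|i IHi] /andP[lein nN].
  rewrite vn0 (IHn n N) ?leqnn 1?ltnW //.
  by apply: eq_bigr => m _; rewrite bell_coefn0.
case: N IHi nN => // N IHi nN.
rewrite vS // IHi ?nN 1?ltnW // (IHn i N); last by apply/andP; split.
rewrite !big_ord_recl !bell_coef0 -addrA; congr (_ + _).
rewrite big_distrr -big_split /=; apply: eq_bigr => m _.
by rewrite bell_coefS // /bump /= add1n exprS; ring.
Qed.

(* Row a >= 1 holds the coefficients of P_(a+1) - 1, where P_n is the reversed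
   Touchard polynomial; row 0 comes from the constant term 1 of the weight. *)
Definition weight_coef : nat -> nat -> R :=
  direct_sum1 (fun a m => bell_coef a.+2 0 m.+1).

(** Apart from the corner, this is a submatrix of the matrix of [delayed]: its rows belong to a(n,
    0), n >= 2, and subtracting 1 from P_n drops column 0. *)
Lemma tp_weight_coef (M : nat) : tp M weight_coef.
Proof.
case: M => [[|n] f g fi gi gM|M]; [by rewrite minor0|by have := gM ord0|].
apply: tp_direct_sum1 => r f g fi gi gM.
rewrite (_ : minor _ f g = minor (fun s m => delayed R bell_delay m s)
   (fun i => 'C((f i).+2, 2)) (succn \o g)); last first.
  by apply: eq_minor => i j; rewrite /bell_coef addn0.
apply: (@tp_delayed R bell_delay M.+2) => [|i j ij|i j ij|j] /=.
- exact: bell_delay_homo.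
- have := fi _ _ ij; move: (f i) (f j) => a b.
  elim: b => // b IH; rewrite ltnS leq_eqVlt => /predU1P[->|/IH h].
    by rewrite [ltnRHS]binS2; lia.
  by apply: (leq_trans h); rewrite [leqRHS]binS2; lia.
- by have := gi _ _ ij; lia.
- by have := gM j; lia.
Qed.

Lemma weight_coef_diag (a : nat) : weight_coef a a = 1.
Proof. by case: a => //= a; rewrite bell_coefn0 bell_coef_lead. Qed.

Lemma weight_coef_eq0 (a m : nat) : (a < m)%N -> weight_coef a m = 0.
Proof.
case: a m => [|a] [|m] //= h; rewrite bell_coefn0 bell_coef_eq0 //.
by rewrite eqxx; lia.
Qed.

Lemma minor_weight_coef_diag (r : nat) (f : 'I_r -> nat) :
  increasing f -> minor weight_coef f f = 1.
Proof.
move=> fi; rewrite /minor det_trig.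
  by apply: big1 => i _; rewrite mxE weight_coef_diag.
by apply/is_trig_mxP => i j ij; rewrite mxE weight_coef_eq0 // fi.
Qed.

Definition weight_poly (N : nat) (l : R) (a : nat) : R :=
  \sum_(m < N) l ^+ m * weight_coef a m.

(** The Cauchy-Binet term whose columns equal the rows [f]: its coefficient minor is 1 by unit
    triangularity. *)
Lemma minor_weight_poly_ge (r N : nat) (l : 'I_r -> R) (f : 'I_r -> nat) :
  (forall i, 0 < l i) -> (forall i j : 'I_r, (i < j)%N -> l i < l j) ->
  increasing f -> (forall i, f i < N)%N ->
  minor (fun y n => y ^+ n) l f <= r`!%:R * minor (weight_poly N) l f.
Proof.
move=> lp li fi fN.
rewrite -[leLHS]mulr1 -[X in _ * X <= _](minor_weight_coef_diag fi) [minor weight_coef f f]minor_tr.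
apply: (minor_comp_ge (X := fun y n => y ^+ n) (Y := fun m a => weight_coef a m) fN).
move=> g gi gN; apply: mulr_ge0.
  by rewrite minor_tr ltW // minor_exp_gt0.
by rewrite minor_tr (tp_weight_coef (M:=N)).
Qed.

End BellCoefficients.

(** * Truncated expansions of the weight *)

Section Weight.
Variable R : realFieldType.

(** The exponents 0, 2, 3, ...; exponent 1 is absent because P_1 = 1 cancels the linear term. *)
Definition weight_exp (a : nat) : nat := if a is a'.+1 then a'.+2 else 0.

Definition weight_monomial (a : nat) (y : R) : R :=
  y ^+ weight_exp a / (weight_exp a)`!%:R.

Lemma minor_weight_monomial_gt0 (r : nat) (f : 'I_r -> nat) (y : 'I_r -> R) :
  (forall i, 0 < y i) -> (forall i j : 'I_r, (i < j)%N -> y i < y j) ->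
  increasing f -> 0 < minor weight_monomial f y.
Proof.
move=> yp yi fi; rewrite /minor.
have -> : \matrix_(i < r, j < r) weight_monomial (f i) (y j) =
    diag_mx (\row_i ((weight_exp (f i))`!%:R)^-1) *m
    \matrix_(i < r, j < r) y j ^+ weight_exp (f i).
  by apply/matrixP => i j; rewrite mul_diag_mx !mxE mulrC.
rewrite det_mulmx det_diag; apply: mulr_gt0.
  by apply: prodr_gt0 => i _; rewrite mxE invr_gt0 ltr0n fact_gt0.
apply: (minor_exp_gt0 (m := weight_exp \o f)) => // i j /fi /=.
by case: (f i) => [|a]; case: (f j).
Qed.

Definition weight_trunc (N : nat) (l y : R) : R :=
  \sum_(a < N) weight_poly N l a * weight_monomial a y.

(** A bound [c] independent of [N] keeps positivity strict in the limit. It selects the indices 0,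
    ..., r - 1 in two Cauchy-Binet expansions, each costing a factor r!. *)
Lemma minor_weight_trunc_ge (r : nat) (l y : 'I_r -> R) :
  (forall i, 0 < l i) -> (forall i j : 'I_r, (i < j)%N -> l i < l j) ->
  (forall i, 0 < y i) -> (forall i j : 'I_r, (i < j)%N -> y i < y j) ->
  exists2 c : R, 0 < c & forall N, (r <= N)%N -> c <= minor (weight_trunc N) l y.
Proof.
move=> lp li yp yi; pose f (i : 'I_r) : nat := i.
have fi : increasing f by [].
have r0 : 0 < r`!%:R :> R by rewrite ltr0n fact_gt0.
exists (minor (fun y n => y ^+ n) l f * minor weight_monomial f y / r`!%:R / r`!%:R).
  rewrite !divr_gt0 // mulr_gt0 //; last exact: minor_weight_monomial_gt0.
  by rewrite minor_tr minor_exp_gt0.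
move=> N rN; have fN i : (f i < N)%N by exact: leq_trans (ltn_ord i) rN.
rewrite !ler_pdivrMr // -mulrA [X in _ <= X]mulrC -mulrA.
apply: (@le_trans _ _ (r`!%:R * minor (weight_poly N) l f * minor weight_monomial f y)).
  rewrite ler_pM2r; first exact: minor_weight_poly_ge.
  exact: minor_weight_monomial_gt0.
rewrite -mulrA ler_pM2l //.
apply: (minor_comp_ge fN).
move=> g gi gN; apply: mulr_ge0; last first.
  exact/ltW/minor_weight_monomial_gt0.
rewrite -(pmulr_rge0 _ r0).
apply: le_trans (minor_weight_poly_ge lp li gi gN).
by rewrite minor_tr ltW // minor_exp_gt0.
Qed.

(** Index a >= 1 stands for exponent a + 1, so N + 1 terms match the exponents below N + 2. The
    terms n = 0 and n = 1 of the two sums cancel, and 1 is the term a = 0. *)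
Lemma weight_truncE (l y : R) (v : nat -> nat -> R) (N : nat) :
  v 0 0 = 1 -> (forall n, v n.+1 0 = v n n) ->
  (forall n i, (i <= n)%N -> v n.+1 i.+1 = v n.+1 i + l * v n i) ->
  weight_trunc N.+1 l y =
  1 + \sum_(0 <= n < N.+2) (v n 0 * y ^+ n / n`!%:R) -
      \sum_(0 <= n < N.+2) (y ^+ n / n`!%:R).
Proof.
move=> v0 vn0 vS; have v10 : v 1 0 = 1 by rewrite vn0.
rewrite -addrA -sumrB big_nat_recl // big_nat_recl // v0 v10 !mul1r !subrr !add0r.
rewrite /weight_trunc big_ord_recl; congr (_ + _).
  rewrite /weight_poly big_ord_recl big1 ?addr0 => [|m _].
    by rewrite /weight_monomial /= !mulr1 invr1 !expr0 !mulr1.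
  by rewrite weight_coef_eq0 ?mulr0.
rewrite big_mkord; apply: eq_bigr => a _.
rewrite -mulrA -[X in _ = _ - X]mul1r -mulrBl; congr (_ * _).
rewrite vn0 (bell_triangleE v0 vn0 vS (N := N.+1)); last by have := ltn_ord a; lia.
rewrite big_ord_recl bell_coef0 mulr1 addrC addKr.
rewrite /weight_poly big_ord_recl mulr0 add0r.
by apply: eq_bigr => m _; rewrite mulrC -bell_coefn0.
Qed.

End Weight.

(** * Limits of series and minors *)

Section Series.
Variable R : realType.

Lemma nneseries_EFin (u : nat -> R) (a : R) :
  series u @ \oo --> a -> (\sum_(k <oo) (u k)%:E = a%:E)%E.
Proof.
move=> h; apply/cvg_lim => //.
rewrite (_ : (fun n => _) = EFin \o series u); first exact: cvg_comp h _.
by apply/funext => n /=; rewrite sumEFin.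
Qed.

Lemma cvg_series_EFin (u : nat -> R) (a : R) : (forall k, 0 <= u k) ->
  (\sum_(k <oo) (u k)%:E = a%:E)%E -> series u @ \oo --> a.
Proof.
move=> u0 h.
have c : cvgn (series u) by apply: nnseries_is_cvg => //; rewrite h ltry.
have := nneseries_EFin c; rewrite h => -[->]; exact: c.
Qed.

(** Tonelli for nonnegative double series: the sums are exchanged in the extended reals, and the
    finite value [c] gives convergence of the [u] series. *)
Lemma cvg_series_exchange (a : nat -> nat -> R) (u v : nat -> R) (c : R) :
  (forall n k, 0 <= a n k) ->
  (forall n, series (a n) @ \oo --> u n) ->
  (forall k, series (a ^~ k) @ \oo --> v k) ->
  series v @ \oo --> c -> series u @ \oo --> c.
Proof.
move=> a0 hu hv hc.
have u0 n : 0 <= u n.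
  rewrite -(cvg_lim _ (hu n)) //; apply: limr_ge; first by apply/cvg_ex; exists (u n).
  by apply: nearW => N; apply: sumr_ge0.
apply: cvg_series_EFin => //.
under eq_eseriesr do rewrite -(nneseries_EFin (hu _)).
rewrite nneseries_interchange => [|i j]; last by rewrite lee_fin.
under eq_eseriesr do rewrite (nneseries_EFin (hv _)).
exact: nneseries_EFin.
Qed.

Lemma cvg_series_exp (x : R) : series (exp_coeff x) @ \oo --> expR x.
Proof. exact: is_cvg_series_exp_coeff. Qed.

Lemma cvg_minor (S T : Type) (X : nat -> S -> T -> R) (Y : S -> T -> R) (r : nat)
    (f : 'I_r -> S) (g : 'I_r -> T) :
  (forall i j, X n (f i) (g j) @[n --> \oo] --> Y (f i) (g j)) ->
  minor (X n) f g @[n --> \oo] --> minor Y f g.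
Proof.
move=> h; rewrite /minor /determinant.
apply: cvg_big => [|s _]; first exact: add_continuous.
apply: cvgM; first exact: cvg_cst.
apply: cvg_big => [|i _]; first exact: mul_continuous.
rewrite mxE; under eq_fun do rewrite mxE; exact: h.
Qed.

End Series.

(** * Dobinski's formula and the weight *)

Section Dobinski.
Variables (R : realType) (z : R).
Hypothesis z0 : 0 < z.

(** Divided by [expR z], the sum over k is the mean of K^p (K + 1)^q for a Poisson variable K of
    parameter z; q is the position in a row of the Bell triangle. *)
Definition dobinski_term (p q k : nat) : R :=
  z ^+ k * (k%:R ^+ p * k.+1%:R ^+ q) / k`!%:R.

Definition dobinski (p q : nat) : R := limn (series (dobinski_term p q)).

Lemma dobinski_term_ge0 (p q k : nat) : 0 <= dobinski_term p q k.
Proof.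
by rewrite divr_ge0 // !mulr_ge0 // ?exprn_ge0 // ltW.
Qed.

Lemma exprn_le_fact_expR (x : R) (n : nat) : 1 <= x -> x ^+ n <= n.+1`!%:R * expR x.
Proof.
move=> x1; have x0 : 0 <= x by exact: le_trans x1.
apply: (@le_trans _ _ (x ^+ n.+1)); first exact: ler_weXn2l.
rewrite -ler_pdivrMl ?ltr0n ?fact_gt0 // mulrC.
by apply: le_trans (expR_ge1Dxn n x0); rewrite lerDr.
Qed.

Lemma cvg_dobinski (p q : nat) :
  series (dobinski_term p q) @ \oo --> dobinski p q.
Proof.
(* A majorant, as k^p (k + 1)^q <= (k + 1)^(p + q) <= (p + q + 1)! e^(k + 1). *)
pose b k : R := ((p + q).+1`!%:R * expR 1) *: exp_coeff (z * expR 1) k.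
apply: (@series_le_cvg _ _ b) => [k|k|k|].
- exact: dobinski_term_ge0.
- by rewrite /b /= !mulr_ge0 ?invr_ge0 ?exprn_ge0 ?mulr_ge0 ?expR_ge0 // ltW.
- rewrite /b /dobinski_term /exp_coeff /= /GRing.scale /= [leRHS]mulrA ler_wpM2r ?invr_ge0 //.
  rewrite exprMn [leRHS]mulrCA ler_pM2l ?exprn_gt0 //.
  apply: (@le_trans _ _ (k.+1%:R ^+ (p + q))).
    by rewrite exprD ler_wpM2r ?exprn_ge0 // lerXn2r ?nnegrE // ler_nat.
  apply: le_trans (exprn_le_fact_expR _ _) _; first by rewrite ler1n.
  by rewrite -mulrA -exprS -expRM_natl mulr1.
- by apply: is_cvg_seriesZ; exact: is_cvg_series_exp_coeff.
Qed.

Lemma dobinskiSr (p q : nat) : dobinski p q.+1 = dobinski p.+1 q + dobinski p q.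
Proof.
rewrite /dobinski -lim_seriesD; [|exact: cvg_dobinski..].
congr (limn (series _)); apply/funext => k.
by rewrite fctE /dobinski_term !exprS; ring.
Qed.

(** The term k = 0 vanishes; in the others k / k! = 1 / (k - 1)!, and k is shifted by one. *)
Lemma dobinskiSl (n : nat) : dobinski n.+1 0 = z * dobinski 0 n.
Proof.
have h := @cvg_dobinski n.+1 0; rewrite -cvg_shiftS in h.
rewrite -(cvg_lim _ h) //; apply: cvg_lim => //.
rewrite (_ : (fun k => _) = z \*: series (dobinski_term 0 n)).
  exact: cvgZl_tmp (@cvg_dobinski 0 n).
apply/funext => k; rewrite /series /= big_nat_recl //.
rewrite {1}/dobinski_term expr0n /= mul0r mulr0 mul0r add0r.
rewrite /GRing.scale /= big_distrr /=; apply: eq_bigr => i _.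
rewrite /dobinski_term expr0 mulr1 mul1r factS natrM exprS exprS.
by field; rewrite nat1r !pnatr_eq0 -lt0n fact_gt0.
Qed.

Lemma dobinski00 : dobinski 0 0 = expR z.
Proof.
rewrite /dobinski /expR; congr (limn (series _)); apply/funext => k.
by rewrite /dobinski_term /exp_coeff /= !expr0 !mulr1.
Qed.

(** Summing over n first turns the double series into that of z^k e^(k t) / k!, the exponential
    series at z e^t. *)
Lemma cvg_dobinski_egf (t : R) : 0 <= t ->
  series (fun n => t ^+ n / n`!%:R * dobinski n 0) @ \oo --> expR (z * expR t).
Proof.
move=> t0.
apply: (@cvg_series_exchange _
  (fun n k => t ^+ n / n`!%:R * dobinski_term n 0 k) _ (exp_coeff (z * expR t))).
- move=> n k; apply: mulr_ge0; last exact: dobinski_term_ge0.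
  by rewrite divr_ge0 // exprn_ge0.
- move=> n.
  rewrite (_ : series _ = (t ^+ n / n`!%:R) \*: series (dobinski_term n 0)).
    exact: cvgZl_tmp (@cvg_dobinski n 0).
  by apply/funext => k; rewrite /series /= /GRing.scale /= big_distrr.
- move=> k.
  rewrite (_ : series _ = (z ^+ k / k`!%:R) \*: series (exp_coeff (k%:R * t))).
    have -> : exp_coeff (z * expR t) k = (z ^+ k / k`!%:R) *: expR (k%:R * t).
      by rewrite /exp_coeff /= exprMn -expRM_natl /GRing.scale /=; ring.
    exact: cvgZl_tmp (@cvg_series_exp _ _).
  apply/funext => n; rewrite /series /= /GRing.scale /= big_distrr /=.
  apply: eq_bigr => i _; rewrite /dobinski_term /exp_coeff /= expr0 mulr1 exprMn.
  by field; rewrite !pnatr_eq0 -!lt0n !fact_gt0.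
- exact: cvg_series_exp.
Qed.

End Dobinski.

(** * The weight as the limit of its truncations *)

Section Weight.
Variable R : realType.

(** [w4_tilde] in the variable y = ln (1 + x). *)
Definition weight (l y : R) : R := expR ((expR (l * y) - 1) / l) - (expR y - 1).

Lemma cvg_weight_trunc (l y : R) : 0 < l -> 0 < y ->
  weight_trunc n l y @[n --> \oo] --> weight l y.
Proof.
move=> l0 y0; pose z := l^-1; have z0 : 0 < z by rewrite invr_gt0.
have lz : l * z = 1 by rewrite mulfV ?gt_eqF.
(* The triangle entries a(n, i) at l, as Dobinski sums. *)
pose v n i := l ^+ n * expR (- z) * dobinski z (n - i) i.
have v00 : v 0 0 = 1.
  by rewrite /v expr0 mul1r dobinski00 -expRD addNr expR0.
have vn0 n : v n.+1 0 = v n n.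
  by rewrite /v subn0 subnn dobinskiSl // exprS -[RHS]mul1r -lz; ring.
have vS n i : (i <= n)%N -> v n.+1 i.+1 = v n.+1 i + l * v n i.
  by move=> lein; rewrite /v subSS subSn // dobinskiSr // exprS; ring.
rewrite -cvg_shiftS.
under eq_fun do rewrite (weight_truncE y _ v00 vn0 vS).
rewrite /weight opprB addrCA addrA.
have c (u : nat -> R) a : series u @ \oo --> a ->
    \sum_(0 <= n < k.+2) u n @[k --> \oo] --> a.
  move=> h; have := h; rewrite -cvg_shiftS -cvg_shiftS; exact.
apply: cvgB; last by apply: c; exact: cvg_series_exp.
apply: cvgD; first exact: cvg_cst.
apply: c.
rewrite (_ : (fun n => _) = expR (- z) \*:
  (fun n => (l * y) ^+ n / n`!%:R * dobinski z n 0)); last first.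
  apply/funext => n; rewrite /v subn0 /= /GRing.scale /= exprMn; ring.
rewrite (_ : (_ - 1) / l = - z + z * expR (l * y)); last by rewrite /z; ring.
rewrite expRD seriesZ.
apply: cvgZl_tmp; apply: cvg_dobinski_egf => //.
by rewrite mulr_ge0 // ltW.
Qed.

Lemma minor_weight_gt0 (r : nat) (l y : 'I_r -> R) :
  (forall i, 0 < l i) -> (forall i j : 'I_r, (i < j)%N -> l i < l j) ->
  (forall i, 0 < y i) -> (forall i j : 'I_r, (i < j)%N -> y i < y j) ->
  0 < minor weight l y.
Proof.
move=> lp li yp yi.
have [c c0 cP] := minor_weight_trunc_ge lp li yp yi.
have h := cvg_minor (fun i j => cvg_weight_trunc (lp i) (yp j)).
apply: (lt_le_trans c0); rewrite -(cvg_lim _ h) //.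
apply: limr_ge; first by apply/cvg_ex; eexists; exact: h.
by exists r => // N /= /cP.
Qed.

Lemma w4_tilde_weight (l x : R) : 0 < l -> 0 < x ->
  w4_tilde l x = weight l (ln (1 + x)).
Proof.
move=> l0 x0; have x1 : 0 < 1 + x by rewrite addr_gt0.
by rewrite /w4_tilde /weight /powR gt_eqF // lnK ?posrE // addrAC subrr add0r.
Qed.

End Weight.

Theorem mainTheorem7 (R : realType) : STP_infinity (@w4_tilde R).
Proof.
move=> r l x _ l0 li x0 xi.
have -> : \matrix_(i < r, j < r) w4_tilde (l i) (x j) =
    \matrix_(i < r, j < r) weight (l i) (ln (1 + x j)).
  by apply/matrixP => i j; rewrite !mxE w4_tilde_weight.
have x1 i : 0 < 1 + x i by rewrite addr_gt0.
have revP (i j : 'I_r) : (i < j)%N -> (rev_ord j < rev_ord i)%N.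
  by move=> ij /=; have := ltn_ord j; lia.
change (0 < minor (@weight R) l (fun j => ln (1 + x j))).
(* Reversing both index orders preserves the determinant and makes the decreasing families
   increasing. *)
rewrite -minor_rev; apply: minor_weight_gt0 => [i|i j ij|i|i j ij] //=.
- exact/li/revP.
- by rewrite ln_gt0 // ltrDl.
- by rewrite ltr_ln ?posrE // ltrD2l; exact/xi/revP.
Qed.
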